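(* Let $A\in M_n(\mathbb{Z})$ be invertible such that $x\mapsto A^{-1}x$ is a similarity with respect to Euclidean distance, and let $D$ be a subset of a complete residue system mod $A$ such that every element of $T_{A,D-D}$ has a unique $(A,D-D)$-representation. Let $m\ge1$. Then for every $\lambda\in[0,\dim_B T_{A,D}]$, the level set $(\Theta^{(m)}_{A,D})^{-1}(\lambda)$ is dense in $F^{(m)}_{A,D}$.
   Context: A similarity means a map $f$ with $\|f(x)-f(y)\|=c\|x-y\|$ for some $c\in(0,1)$ and all $x,y$. For finite $E\subset\mathbb{R}^n$, $\pi_{A,E}((e_j)_{j\ge1})=\sum_{j\ge1}A^{-j}e_j$, $T_{A,E}=\pi_{A,E}(E^{\mathbb{N}})$, and an $(A,E)$-representation of $x$ is a sequence $(e_j)\in E^{\mathbb{N}}$ with $\pi_{A,E}((e_j))=x$. A complete residue system mod $A$ is a set $\mathcal{D}\subset\mathbb{Z}^n$ mapping bijectively onto $\mathbb{Z}^n/A\mathbb{Z}^n$. For $\vec\alpha=(\alpha^{(1)},\dots,\alpha^{(m)})\in(\mathbb{R}^n)^m$ write $T(\vec\alpha)=T_{A,D}\cap\bigcap_{i=1}^m(T_{A,D}+\alpha^{(i)})$. $F^{(m)}_{A,D}=\{\vec\alpha\in(T_{A,D-D})^m: T(\vec\alpha)\ne\emptyset\}$, and $\Theta^{(m)}_{A,D}$ is the function on $\{\vec\alpha\in F^{(m)}_{A,D}:\dim_B T(\vec\alpha)\text{ exists}\}$ given by $\Theta^{(m)}_{A,D}(\vec\alpha)=\dim_B T(\vec\alpha)$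 (box-counting dimension). *)

(* Defs.v *)
From HB Require Import structures.
From mathcomp Require Import all_boot all_order all_algebra.
From mathcomp Require Import all_classical all_reals all_analysis.
Set Implicit Arguments. Unset Strict Implicit. Unset Printing Implicit Defensive.
Import Order.TTheory GRing.Theory Num.Theory.
Import numFieldNormedType.Exports.
Local Open Scope classical_set_scope.
Local Open Scope ring_scope.

Section Defs.
Variables (R : realType) (n : nat).

Definition enorm (x : 'cV[R]_n) : R := Num.sqrt (\sum_(i < n) (x i 0) ^+ 2).

Definition zvec (z : 'cV[int]_n) : 'cV[R]_n := map_mx (fun k : int => k%:~R) z.

Definition Ainv (A : 'M[int]_n) : 'M[R]_n := invmx (map_mx (fun k : int => k%:~R) A).

Definition inv_similarity (A : 'M[int]_n) : Prop :=
  exists c : R, 0 < c < 1 /\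
    forall x y : 'cV[R]_n, enorm (Ainv A *m x - Ainv A *m y) = c * enorm (x - y).

(* partial sums  sum_{j=1}^{N} A^{-j} e_j, the sequence e being indexed from 0,
   i.e. e k stands for e_{k+1} *)
Definition psum (A : 'M[int]_n) (e : nat -> 'cV[int]_n) (N : nat) : 'cV[R]_n :=
  \sum_(k < N) (Ainv A ^+ k.+1 *m zvec (e k)).

Definition is_rep (A : 'M[int]_n) (E : set 'cV[int]_n) (e : nat -> 'cV[int]_n)
  (x : 'cV[R]_n) : Prop :=
  (forall k, E (e k)) /\
  (forall eps : R, 0 < eps -> exists N0 : nat, forall N, (N0 <= N)%N ->
      enorm (psum A e N - x) < eps).

Definition Tset (A : 'M[int]_n) (E : set 'cV[int]_n) : set 'cV[R]_n :=
  [set x | exists e, is_rep A E e x].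

Definition diffset (D : set 'cV[int]_n) : set 'cV[int]_n :=
  [set z | exists d1 d2, D d1 /\ D d2 /\ z = d1 - d2].

Definition complete_residue_system (A : 'M[int]_n) (Dc : set 'cV[int]_n) : Prop :=
  forall z : 'cV[int]_n,
    exists d, Dc d /\ (exists k, z - d = A *m k) /\
      (forall d', Dc d' -> (exists k, z - d' = A *m k) -> d' = d).

Definition covers_by (S : set 'cV[R]_n) (delta : R) (N : nat) : Prop :=
  exists cs : seq 'cV[R]_n, size cs = N /\
    forall x, S x -> exists2 c, c \in cs & enorm (x - c) <= delta.

Definition Ncov (S : set 'cV[R]_n) (delta : R) : nat :=
  xget 0%N [set N | covers_by S delta N /\ forall M, covers_by S delta M -> (N <= M)%N].

Definition bounded_set (S : set 'cV[R]_n) : Prop :=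
  exists r : R, forall x, S x -> enorm x <= r.

Definition has_box_dim (S : set 'cV[R]_n) (s : R) : Prop :=
  S !=set0 /\ bounded_set S /\
  (fun delta : R => ln (Ncov S delta)%:R / (- ln delta)) @ 0^'+ --> s.

Definition Tinter (m : nat) (A : 'M[int]_n) (D : set 'cV[int]_n)
  (alpha : 'I_m -> 'cV[R]_n) : set 'cV[R]_n :=
  [set x | Tset A D x /\ forall i, Tset A D (x - alpha i)].

Definition Fset (m : nat) (A : 'M[int]_n) (D : set 'cV[int]_n) :
  set ('I_m -> 'cV[R]_n) :=
  [set alpha | (forall i, Tset A (diffset D) (alpha i)) /\ Tinter A D alpha !=set0].

Definition level_set (m : nat) (A : 'M[int]_n) (D : set 'cV[int]_n) (lam : R) :
  set ('I_m -> 'cV[R]_n) :=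
  [set alpha | Fset A D alpha /\ has_box_dim (Tinter A D alpha) lam].

Definition dense_in (m : nat) (X Y : set ('I_m -> 'cV[R]_n)) : Prop :=
  forall alpha, Y alpha -> forall eps : R, 0 < eps ->
    exists2 beta, X beta & forall i, enorm (alpha i - beta i) < eps.

End Defs.

(* Main.v *)
Require Import Defs.
From HB Require Import structures.
From mathcomp Require Import all_boot all_order all_algebra.
From mathcomp Require Import all_classical all_reals all_analysis.
From mathcomp Require Import ring lra zify.
Import Order.TTheory GRing.Theory Num.Theory.
Import numFieldNormedType.Exports.
Local Open Scope classical_set_scope.
Local Open Scope ring_scope.
Set Implicit Arguments. Unset Strict Implicit. Unset Printing Implicit Defensive.

(** By uniqueness of the [(A, D - D)]-representations, an intersection of
    translates by points with digit sequences [g i] is the set of all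
    [sum_j A^-j e_j] with [e_j] in the digit set
    [D_j = D \cap \bigcap_i (D + g i j)].  Such a set is covered at scale
    [c ^+ k] by its [\prod_(j < k) #|D_j|] prefixes, and no better up to a
    constant factor: prefixes of length [k] are, after rescaling by [A ^+ k],
    distinct integer vectors, boundedly many of which fit in one ball.  Its box
    dimension is therefore the limit of [\sum_(j < k) ln #|D_j| / (- k ln c)].
    Given a point of [F], keep its first [K] digits and afterwards use only the
    digit [0], for which [D_j = D], and a difference of maximal length, for which
    [D_j] is a singleton; choosing the digit [0] with frequency [lam / dimT]
    along a Beatty sequence yields a point of the level set. *)

(** * Covering numbers *)

(** Once one finite cover exists, a least size exists by well-ordering, so the default [0] of [xget]
    in [Ncov] is not reached. *)
Lemma NcovP (R : realType) (n : nat) (S : set 'cV[R]_n) (delta : R) (N0 : nat) :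
  covers_by S delta N0 ->
  covers_by S delta (Ncov S delta) /\
  (forall M, covers_by S delta M -> (Ncov S delta <= M)%N).
Proof.
move=> cov; apply: (@xgetPex _ 0%N [set N | covers_by S delta N /\
  forall M, covers_by S delta M -> (N <= M)%N]).
have cov' : exists N, `[< covers_by S delta N >] by exists N0; apply/asboolP.
exists (ex_minn cov'); case: ex_minnP => N /asboolP hN hmin; split=> // M hM.
by apply: hmin; apply/asboolP.
Qed.

(** * Residues of integer vectors and differences of digits *)

Section ResidueVectors.
Variables (n b : nat).

Definition modvec (y : 'cV[int]_n) : 'cV['I_b.+1]_n :=
  \col_i inord (absz (modz (y i 0)%R b.+1)).

Lemma modvec_dvd y y' : modvec y = modvec y' ->
  forall i, (b.+1 %| (y i 0 - y' i 0)%R)%Z.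
Proof.
move=> /matrixP yy i; have := yy i 0; rewrite !mxE => /(congr1 val).
have mb (z : int) : (absz (modz z b.+1) < b.+1)%N.
  have : modz z b.+1 < b.+1 by rewrite ltz_pmod.
  have : 0 <= modz z b.+1 by rewrite modz_ge0.
  by move: (modz z b.+1); clear; lia.
rewrite /= !inordK// => mm; rewrite -eqz_mod_dvd; apply/eqP.
have : 0 <= modz (y i 0)%R b.+1 by rewrite modz_ge0.
have : 0 <= modz (y' i 0)%R b.+1 by rewrite modz_ge0.
by move: mm; move: (modz (y i 0)%R b.+1) (modz (y' i 0)%R b.+1); clear; lia.
Qed.

End ResidueVectors.

(** Since [A *m (\adj A *m q) = \det A *: q], vectors congruent entrywise modulo the determinant are
    congruent modulo [A]. An element of [Dc] is thus determined by its residue vector, and these are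
    finitely many. *)
Lemma residue_system_finite (n : nat) (A : 'M[int]_n) (Dc : set 'cV[int]_n) :
  \det A != 0 -> complete_residue_system A Dc -> finite_set Dc.
Proof.
move=> detA residues; set b := (absz (\det A)).-1.
have bE : b.+1 = absz (\det A) by rewrite prednK// lt0n absz_eq0.
pose g (r : 'cV['I_b.+1]_n) := xget 0 [set d | Dc d /\ modvec b d = r].
apply: (@sub_finite_set _ _ (range g)); last exact/finite_image/finite_finset.
move=> d Dd; exists (modvec b d) => //.
have [Dg gd] : Dc (g (modvec b d)) /\ modvec b (g (modvec b d)) = modvec b d.
  by apply: (@xgetPex _ 0 [set d' | Dc d' /\ modvec b d' = modvec b d]); exists d.
have /choice[q hq] i : exists z, d i 0 - (g (modvec b d)) i 0 = \det A * z.
  have := modvec_dvd (esym gd) i; rewrite bE dvdzE /= -dvdzE => /dvdzP[z ->].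
  by exists z; rewrite mulrC.
have [d0 [_ [_ h]]] := residues d.
have -> : g (modvec b d) = d0; last first.
  by symmetry; apply: h => //; exists 0; rewrite subrr mulmx0.
apply: h => //.
exists (\adj A *m \col_i q i); rewrite mulmxA mul_mx_adj mul_scalar_mx.
by apply/matrixP => i j; rewrite (ord1 j) !mxE -hq.
Qed.

(* If [d1 - d2] has maximal length among differences, both [d - d2] and
   [d1 - (d - (d1 - d2))] are at most as long, and the parallelogram identity
   gives [d = d1]. *)
Lemma singleton_translate (n : nat) (s : seq 'cV[int]_n) d0 : d0 \in s ->
  exists d1 d2, [/\ d1 \in s, d2 \in s &
    forall d, d \in s -> d - (d1 - d2) \in s -> d = d1].
Proof.
move=> d0s; have s0 : (0 < size s)%N by case: (s) d0s.
pose N (u : 'cV[int]_n) : int := \sum_(i < n) u i 0 ^+ 2.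
pose F (p : 'I_(size s) * 'I_(size s)) := N (s`_p.1 - s`_p.2).
pose p0 : 'I_(size s) * 'I_(size s) := (Ordinal s0, Ordinal s0).
pose p := [arg max_(p > p0) F p]%O.
have Fp q : F q <= F p by rewrite /p; case: arg_maxP => // r _; apply.
have Nmax u v : u \in s -> v \in s -> N (u - v) <= F p.
  move=> us vs; have us' := us; have vs' := vs; rewrite -!index_mem in us' vs'.
  by have := Fp (Ordinal us', Ordinal vs'); rewrite /F /= !nth_index.
exists s`_p.1, s`_p.2; split; try exact: mem_nth.
move=> d ds ds'; have l1 := Nmax _ _ ds (mem_nth 0 (ltn_ord p.2)).
have l2 := Nmax _ _ (mem_nth 0 (ltn_ord p.1)) ds'.
set d1 := s`_p.1 in l1 l2 ds' *; set d2 := s`_p.2 in l1 l2 ds' *.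
have par : N (d - d2) + N (d1 - (d - (d1 - d2))) = 2 * F p + 2 * N (d - d1).
  rewrite /F /N -/d1 -/d2 !mulr_sumr -!big_split; apply: eq_bigr => i _ /=.
  by rewrite !mxE; ring.
have : N (d - d1) <= 0.
  rewrite -(pmulr_rle0 _ (ltr0n _ 2)) -(lerD2l (2 * F p)) -par addr0.
  by rewrite mulr_natl mulr2n lerD.
have N0 : 0 <= N (d - d1) by apply: sumr_ge0 => i _; rewrite sqr_ge0.
move=> N1; have /eqP : N (d - d1) = 0 by apply/eqP; rewrite eq_le N1.
rewrite psumr_eq0; last by move=> i _; rewrite sqr_ge0.
move=> /allP dd; apply/matrixP => i j; rewrite (ord1 j).
by have := dd i; rewrite mem_index_enum sqrf_eq0 !mxE subr_eq0 => /(_ isT)/eqP.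
Qed.

(** * Beatty sequences *)

(** For [0 <= t <= 1] the indices [j] with [beatty t j < beatty t j.+1] have frequency [t]. *)
Definition beatty (R : realType) (t : R) j := Num.trunc (t * j%:R).

Lemma beatty_step (R : realType) (t : R) j : 0 <= t <= 1 ->
  beatty t j.+1 = (beatty t j + (beatty t j < beatty t j.+1))%N.
Proof.
move=> /andP[t0 t1]; have h k : 0 <= t * k%:R by rewrite mulr_ge0.
have : (beatty t j <= beatty t j.+1)%N.
  by apply: le_truncn; rewrite ler_wpM2l// ler_nat.
have : (beatty t j.+1 <= (beatty t j).+1)%N.
  rewrite truncn_le_nat -natr1 mulrDr mulr1 -[X in _ < X]natr1.
  by rewrite ltr_leD// truncnS_gt.
by case: ltnP; lia.
Qed.

(** From [K] on the logarithm grows by [ln q] exactly at the jumps. The first [K] factors cost at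
    most [ln q] each, and rounding [t * k] costs one more [ln q]. *)
Lemma ln_prod_beatty (R : realType) (t : R) (q K : nat) (sz : nat -> nat) :
  0 <= t <= 1 -> (forall j, (0 < sz j <= q)%N) ->
  (forall j, (K <= j)%N ->
    sz j = if (beatty t j < beatty t j.+1)%N then q else 1%N) ->
  forall k, `|ln (\prod_(j < k) sz j)%N%:R - t * ln q%:R * k%:R| <=
    (K%:R + 1) * ln (q%:R : R).
Proof.
move=> t01 hsz hK k; have /andP[t0 t1] := t01.
have q0 : (0 < q)%N by have /andP[] := hsz 0%N; exact: leq_trans.
have lq0 : 0 <= ln (q%:R : R) by rewrite ln_ge0// ler1n.
have h1 : `|ln (\prod_(j < k) sz j)%N%:R - (beatty t k)%:R * ln q%:R| <=
    (minn k K)%:R * ln (q%:R : R).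
  elim: k => [|k IH].
    by rewrite big_ord0 ln1 /beatty mulr0 truncn0 mul0r subr0 normr0 mulr_ge0.
  have /andP[s0 sq] := hsz k.
  have P0 : (0 < \prod_(j < k) sz j)%N.
    by apply: prodn_gt0 => j; have /andP[] := hsz j.
  rewrite big_ord_recr/= natrM lnM ?posrE ?ltr0n//.
  rewrite beatty_step// natrD mulrDl opprD addrACA.
  have [Kk|kK] := leqP K k.
    rewrite (minn_idPr (leqW Kk)) hK//; rewrite (minn_idPr Kk) in IH.
    by case: ifP => _; rewrite ?ln1 ?mul1r ?mul0r ?subrr ?subr0 addr0.
  rewrite (minn_idPl kK) -natr1 mulrDl mul1r.
  apply: le_trans (ler_normD _ _) _; apply: lerD.
    by apply: le_trans IH _; rewrite (minn_idPl (ltnW kK)).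
  have ls0 : 0 <= ln ((sz k)%:R : R) by rewrite ln_ge0// ler1n.
  have lsq : ln (sz k)%:R <= ln (q%:R : R) by rewrite ler_ln ?posrE ?ltr0n// ler_nat.
  by rewrite ler_norml; case: ltnP => _ /=; apply/andP; split; lra.
have /andP[b1 b2] : (beatty t k)%:R <= t * k%:R < (beatty t k).+1%:R.
  by apply: truncn_itv; rewrite mulr_ge0.
have mK : (minn k K)%:R * ln (q%:R : R) <= K%:R * ln q%:R.
  by rewrite ler_wpM2r// ler_nat geq_minr.
apply: le_trans (ler_distD ((beatty t k)%:R * ln q%:R) _ _) _.
rewrite mulrDl; apply: lerD; first exact: le_trans mK.
rewrite mulrAC -mulrBl normrM (ger0_norm lq0) ler_wpM2r//.
by rewrite -natr1 in b2; rewrite ler_norml; apply/andP; split; lra.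
Qed.

(** * The Euclidean norm *)

Section EuclideanNorm.
Variables (R : realType) (n : nat).
Implicit Types x y : 'cV[R]_n.

Lemma enorm_ge0 x : 0 <= enorm x.
Proof. exact: sqrtr_ge0. Qed.

Lemma enorm_sqr x : enorm x ^+ 2 = \sum_(i < n) x i 0 ^+ 2.
Proof. by rewrite sqr_sqrtr// sumr_ge0// => i _; rewrite sqr_ge0. Qed.

Lemma ler_enorm_sqr x (r : R) : 0 <= r ->
  \sum_(i < n) x i 0 ^+ 2 <= r ^+ 2 -> enorm x <= r.
Proof. by move=> r0; rewrite -enorm_sqr ler_pXn2r// nnegrE// enorm_ge0. Qed.

Lemma enorm0 : enorm (0 : 'cV[R]_n) = 0.
Proof.
rewrite /enorm big1 ?sqrtr0// => i _.
by rewrite mxE expr0n.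
Qed.

Lemma enorm0_eq0 x : enorm x = 0 -> x = 0.
Proof.
move=> x0; apply/matrixP => i j; rewrite (ord1 j) mxE.
have /eqP : \sum_(i < n) x i 0 ^+ 2 = 0 by rewrite -enorm_sqr x0 expr0n.
rewrite psumr_eq0; last by move=> k _; rewrite sqr_ge0.
by move=> /allP/(_ i); rewrite mem_index_enum sqrf_eq0 => /(_ isT)/eqP.
Qed.

Lemma enormN x : enorm (- x) = enorm x.
Proof. by congr Num.sqrt; apply: eq_bigr => i _; rewrite mxE sqrrN. Qed.

Lemma enormBC x y : enorm (x - y) = enorm (y - x).
Proof. by rewrite -enormN opprB. Qed.

Lemma coord_le_enorm x i : `|x i 0| <= enorm x.
Proof.
rewrite -(@ler_pXn2r _ 2)// ?nnegrE ?enorm_ge0// enorm_sqr real_normK ?num_real//.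
by rewrite (bigD1 i)//= lerDl sumr_ge0// => j _; rewrite sqr_ge0.
Qed.

(** Cauchy-Schwarz: the squared length of [enorm y *: x - enorm x *: y] is nonnegative and equals
    [2 * enorm x * enorm y] times the difference of the two sides. Vanishing norms are treated apart
    because this factor is cancelled. *)
Lemma inner_le_enorm x y :
  \sum_(i < n) x i 0 * y i 0 <= enorm x * enorm y.
Proof.
have [x0|x0] := eqVneq (enorm x) 0.
  by rewrite x0 mul0r big1// => i _; rewrite (enorm0_eq0 x0) mxE mul0r.
have [y0|y0] := eqVneq (enorm y) 0.
  by rewrite y0 mulr0 big1// => i _; rewrite (enorm0_eq0 y0) mxE mulr0.
have xp : 0 < enorm x by rewrite lt_def x0 enorm_ge0.
have yp : 0 < enorm y by rewrite lt_def y0 enorm_ge0.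
set s := \sum_(i < n) _.
have : 0 <= \sum_(i < n) (enorm y * x i 0 - enorm x * y i 0) ^+ 2.
  by apply: sumr_ge0 => i _; rewrite sqr_ge0.
have -> : \sum_(i < n) (enorm y * x i 0 - enorm x * y i 0) ^+ 2 =
    \sum_(i < n) (enorm y ^+ 2 * x i 0 ^+ 2 +
      (- (2 * enorm x * enorm y)) * (x i 0 * y i 0) + enorm x ^+ 2 * y i 0 ^+ 2).
  by apply: eq_bigr => i _; ring.
rewrite !big_split/= -!mulr_sumr -!enorm_sqr -/s => h.
have xyp : 0 < enorm x * enorm y by rewrite mulr_gt0.
rewrite -(ler_pM2l xyp); nra.
Qed.

Lemma enormD x y : enorm (x + y) <= enorm x + enorm y.
Proof.
apply: ler_enorm_sqr; first by rewrite addr_ge0 ?enorm_ge0.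
under eq_bigr do rewrite mxE sqrrD.
rewrite !big_split/= -!enorm_sqr sqrrD lerD2r lerD2l mulr2n.
by rewrite lerD ?inner_le_enorm.
Qed.

Lemma enormB_le x y z : enorm (x - z) <= enorm (x - y) + enorm (y - z).
Proof. by apply: le_trans (enormD _ _); rewrite addrA subrK. Qed.

Lemma enorm_sum (I : Type) (r : seq I) (P : pred I) (F : I -> 'cV[R]_n) :
  enorm (\sum_(i <- r | P i) F i) <= \sum_(i <- r | P i) enorm (F i).
Proof.
elim/big_ind2: _ => [|x a y b xa yb|//]; first by rewrite enorm0.
exact: le_trans (enormD _ _) (lerD xa yb).
Qed.

Lemma enorm_le_sum x : enorm x <= \sum_(i < n) `|x i 0|.
Proof.
have -> : x = \sum_(i < n) x i 0 *: delta_mx i 0.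
  rewrite [LHS]matrix_sum_delta; apply: eq_bigr => i _.
  by rewrite big_ord_recl big_ord0 addr0.
apply: le_trans (enorm_sum _ _ _) _; apply: ler_sum => i _.
rewrite summxE (bigD1 i)//= big1 => [|j ji]; last first.
  by rewrite !mxE eq_sym (negPf ji) mulr0.
rewrite !mxE !eqxx mulr1 addr0; apply: ler_enorm_sqr => //.
rewrite (bigD1 i)//= big1 => [|j ji]; last first.
  by rewrite !mxE (negPf ji) mulr0 expr0n.
by rewrite !mxE !eqxx mulr1 addr0 real_normK ?num_real.
Qed.

End EuclideanNorm.

(** * Expansions in base [A] *)

Section Expansions.
Variables (R : realType) (n : nat) (A : 'M[int]_n) (c : R).
Hypothesis detA : \det A != 0.
Hypothesis c01 : 0 < c < 1.
Hypothesis simA : forall x y : 'cV[R]_n,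
  enorm (Ainv R A *m x - Ainv R A *m y) = c * enorm (x - y).
Implicit Types (e f : nat -> 'cV[int]_n) (x : 'cV[R]_n) (B : R).

Let a := Ainv R A.
Let c0 : 0 < c. Proof. by case/andP: c01. Qed.
Let c1 : c < 1. Proof. by case/andP: c01. Qed.

Lemma enorm_Ainv_exp k x : enorm (a ^+ k *m x) = c ^+ k * enorm x.
Proof.
elim: k => [|k IH] in x *; first by rewrite expr0 mul1mx mul1r.
rewrite exprS -mulmxE -mulmxA.
have := simA (a ^+ k *m x) 0; rewrite mulmx0 !subr0 => ->.
by rewrite IH exprS mulrA.
Qed.

Lemma AinvK (z : 'cV[int]_n) : a *m zvec R (A *m z) = zvec R z.
Proof.
have Au : map_mx (fun k : int => k%:~R) A \in unitmx (R := R).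
  by rewrite unitmxE (det_map_mx (intr : {rmorphism int -> R})) unitfE intr_eq0.
by rewrite /zvec (map_mxM (intr : {rmorphism int -> R})) mulmxA mulVmx// mul1mx.
Qed.

Lemma zvecD (u v : 'cV[int]_n) : zvec R (u + v) = zvec R u + zvec R v.
Proof. exact: (map_mxD (intr : {rmorphism int -> R})). Qed.

Lemma zvecB (u v : 'cV[int]_n) : zvec R (u - v) = zvec R u - zvec R v.
Proof. exact: (map_mxB (intr : {rmorphism int -> R})). Qed.

(** Horner's scheme for the [k]-th partial sum multiplied by the [k]-th power of [A], which is an
    integer vector. *)
Fixpoint isum e k : 'cV[int]_n :=
  if k is k'.+1 then A *m isum e k' + e k' else 0.

Lemma psum_isum e k : psum R A e k = a ^+ k *m zvec R (isum e k).
Proof.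
elim: k => [|k IH] /=.
  rewrite /psum big_ord0 expr0 mul1mx /zvec.
  by rewrite (raddf0 (map_mx (intr : {rmorphism int -> R}))).
rewrite /psum big_ord_recr /= -/(psum R A e k) IH zvecD mulmxDr.
by congr (_ + _); rewrite exprSr -mulmxE -mulmxA AinvK.
Qed.

Lemma psumB e f k : psum R A (fun j => e j - f j) k = psum R A e k - psum R A f k.
Proof. by rewrite /psum -sumrB; apply: eq_bigr => i _; rewrite zvecB mulmxBr. Qed.

(** The convergence clause of [is_rep], separated from the constraint on the digits. *)
Definition sums_to e x := forall eps : R, 0 < eps ->
  exists N0 : nat, forall N, (N0 <= N)%N -> enorm (psum R A e N - x) < eps.

Lemma sums_toB e f x y : sums_to e x -> sums_to f y ->
  sums_to (fun j => e j - f j) (x - y).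
Proof.
move=> ex fy eps eps0; have e20 : 0 < eps / 2 by rewrite divr_gt0.
have [N1 h1] := ex _ e20; have [N2 h2] := fy _ e20.
exists (maxn N1 N2) => N; rewrite geq_max => /andP[/h1 l1 /h2 l2].
rewrite psumB opprD addrACA -opprD.
apply: le_lt_trans (enormD _ _) _; rewrite enormN; lra.
Qed.

Lemma psum_cauchy e B k N : (forall j, enorm (zvec R (e j)) <= B) -> (k <= N)%N ->
  enorm (psum R A e N - psum R A e k) <= B / (1 - c) * c ^+ k.
Proof.
move=> eB kN; have B0 : 0 <= B := le_trans (enorm_ge0 _) (eB 0).
have c1' : 0 < 1 - c by rewrite subr_gt0.
(* The sharper bound telescopes: adding the digit at [N] raises it by [c ^+ N * B], which bounds the
   new term. *)
suff h : enorm (psum R A e N - psum R A e k) <= B / (1 - c) * (c ^+ k - c ^+ N).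
  apply: le_trans h _; rewrite ler_wpM2l ?divr_ge0 ?(ltW c1')//.
  by rewrite gerBl exprn_ge0// ltW.
rewrite -(subnK kN); elim: (N - k)%N => [|d IH].
  by rewrite add0n !subrr enorm0 mulr0.
rewrite addSn /psum big_ord_recr/= -/(psum R A e _) addrAC.
apply: le_trans (enormD _ _) _.
apply: le_trans (lerD IH (lexx _)) _.
rewrite enorm_Ainv_exp.
have -> : B / (1 - c) * (c ^+ k - c ^+ (d + k).+1) =
  B / (1 - c) * (c ^+ k - c ^+ (d + k)) + c ^+ (d + k) * B.
  by rewrite exprS; field; rewrite subr_eq0 eq_sym lt_eqF.
rewrite lerD2l exprS; have := eB (d + k)%N.
have p0 : 0 < c ^+ (d + k) by rewrite exprn_gt0.
have q0 := enorm_ge0 (zvec R (e (d + k)%N)).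
move=> h; rewrite mulrAC mulrC ler_pM2l//.
by apply: le_trans h; rewrite ler_piMl// ltW.
Qed.

Lemma sums_to_tail e B k x : (forall j, enorm (zvec R (e j)) <= B) ->
  sums_to e x -> enorm (x - psum R A e k) <= B / (1 - c) * c ^+ k.
Proof.
move=> eB ex; apply/ler_addgt0Pl => eps eps0.
have [N0 h] := ex _ eps0.
have l := h (maxn k N0) (leq_maxr _ _).
have l2 := psum_cauchy eB (leq_maxl k N0).
apply: le_trans (enormB_le _ (psum R A e (maxn k N0)) _) _.
by rewrite lerD// enormBC ltW.
Qed.

(** Each coordinate series is dominated by a geometric series; the vector of coordinate limits is
    the sum. *)
Lemma sums_to_ex e B : (forall j, enorm (zvec R (e j)) <= B) ->
  exists x, sums_to e x.
Proof.
move=> eB; have B0 : 0 <= B := le_trans (enorm_ge0 _) (eB 0).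
pose u (i : 'I_n) : R^nat := fun k => (a ^+ k.+1 *m zvec R (e k)) i 0.
have cvu i : cvgn (series (u i)).
  apply: normed_cvg; rewrite /normed_series_of.
  apply: (@series_le_cvg _ _ (geometric (c * B) c)) => [k|k|k|].
  - exact: normr_ge0.
  - exact: geometric_ge0 (mulr_ge0 (ltW c0) B0) (ltW c0).
  - change (`|u i k| <= c * B * c ^+ k); apply: le_trans (coord_le_enorm _ _) _.
    by rewrite enorm_Ainv_exp exprSr -mulrA mulrC ler_pM2r ?exprn_gt0// ler_pM2l.
  - by apply: is_cvg_geometric_series; rewrite ger0_norm// ltW.
exists (\col_i limn (series (u i))) => eps eps0.
(* With [n.+1] in place of [n], the [n] coordinate errors add up to strictly less than [eps], also
   for [n = 0]. *)
have n0 : 0 < eps / n.+1%:R by rewrite divr_gt0.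
have H i : exists N0, forall N, (N0 <= N)%N ->
    `|limn (series (u i)) - series (u i) N| <= eps / n.+1%:R.
  have /cvgrPdist_le/(_ _ n0)[N0 _ h] := cvu i.
  by exists N0 => N hN; exact: h.
have [g hg] := choice H.
exists (\max_i g i)%N => N hN.
apply: le_lt_trans (enorm_le_sum _) _.
apply: (@le_lt_trans _ _ (\sum_(i < n) eps / n.+1%:R)).
  apply: ler_sum => i _; rewrite !mxE -normrN opprB.
  have := hg i N (leq_trans (leq_bigmax i) hN).
  by rewrite seriesEord /psum summxE.
rewrite sumr_const card_ord -(mulr_natr (eps / _)) -mulrA gtr_pMr//.
by rewrite mulrC ltr_pdivrMr// mul1r ltr_nat.
Qed.

Lemma eventually_geometric_lt C (eps : R) : 0 < eps -> exists k, C * c ^+ k < eps.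
Proof.
move=> eps0; have [C0|C0] := leP C 0.
  by exists 0; apply: le_lt_trans eps0; rewrite mulr_le0_ge0.
have cn : `|c| < 1 by rewrite gtr0_norm.
have /cvgrPdist_lt/(_ (eps / C)) := cvg_expr cn.
rewrite divr_gt0// => /(_ isT)[k _ /(_ k (leqnn _))].
rewrite /= sub0r normrN ger0_norm ?exprn_ge0 ?ltW// => h.
by exists k; rewrite mulrC -ltr_pdivlMr.
Qed.

Lemma isum_ext e f k : (forall j, (j < k)%N -> e j = f j) -> isum e k = isum f k.
Proof.
elim: k => [//|k IH] h /=; rewrite IH => [|j jk]; last by rewrite h// ltnW.
by rewrite h.
Qed.

(** * Box dimension of sets with prescribed digit sets *)

Section DigitSets.
Variables (Dc : set 'cV[int]_n) (Ds : nat -> seq 'cV[int]_n) (B : R).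
Hypothesis residues : complete_residue_system A Dc.
Hypothesis Ds_sub : forall k d, d \in Ds k -> Dc d.
Hypothesis Ds_uniq : forall k, uniq (Ds k).
Hypothesis Ds_neq0 : forall k, exists d, d \in Ds k.
Hypothesis Ds_bound : forall k d, d \in Ds k -> enorm (zvec R d) <= B.

Definition digit_set : set 'cV[R]_n :=
  [set x | exists e, (forall k, e k \in Ds k) /\ sums_to e x].

(** The values of [isum e k] for admissible [e]: partial sums are counted as integer vectors. *)
Fixpoint prefixes k : seq 'cV[int]_n :=
  if k is k'.+1 then
    [seq A *m y + d | y : 'cV[int]_n <- prefixes k', d <- Ds k']
  else [:: 0].

Lemma residue_unique d d' z : Dc d -> Dc d' -> d - d' = A *m z -> d = d'.
Proof.
move=> Dd Dd' dd'; have [d0 [_ [_ h]]] := residues d.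
rewrite (h d Dd); last by exists 0; rewrite subrr mulmx0.
by rewrite (h d' Dd')//; exists z.
Qed.

Lemma mulmx_intI (y y' : 'cV[int]_n) : A *m y = A *m y' -> y = y'.
Proof.
move=> yy'; have /eqP := congr1 (mulmx (\adj A)) yy'.
rewrite !mulmxA mul_adj_mx !mul_scalar_mx => /eqP yy.
apply/matrixP => i j; have /matrixP/(_ i j) := yy.
by rewrite !mxE; apply: mulfI.
Qed.

Lemma size_prefixes k : size (prefixes k) = (\prod_(j < k) size (Ds j))%N.
Proof.
elim: k => [|k IH]; first by rewrite big_ord0.
by rewrite big_ord_recr/= size_allpairs IH.
Qed.

(** The last digit is fixed by the residue modulo [A]; cancelling it and then [A] leaves the shorter
    prefix. *)
Lemma uniq_prefixes k : uniq (prefixes k).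
Proof.
elim: k => [//|k IH] /=; apply: allpairs_uniq => //.
move=> _ _ /allpairsP[[y d] /= [hy hd ->]] /allpairsP[[y' d'] /= [hy' hd' ->]].
move=> /= eq1; have dd : d = d'.
  apply: (@residue_unique _ _ (y' - y) (Ds_sub hd) (Ds_sub hd')).
  by rewrite mulmxBr; apply/eqP; rewrite subr_eq addrAC -eq1 addrAC subrr add0r.
move: eq1; rewrite dd => /addIr /mulmx_intI -> //.
Qed.

Lemma isum_prefixes e k : (forall j, e j \in Ds j) -> isum e k \in prefixes k.
Proof. move=> he; elim: k => [|k IH]; [exact: mem_head | exact: allpairs_f]. Qed.

Lemma prefixes_isum k y : y \in prefixes k ->
  exists e, (forall j, e j \in Ds j) /\ isum e k = y.
Proof.
elim: k y => [|k IH] y.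
  by rewrite inE => /eqP ->; have [e he] := choice Ds_neq0; exists e.
case/allpairsP => [[z d] /= [/IH[e [he ez]] hd ->]].
exists (fun j => if j == k then d else e j); split.
  by move=> j; case: eqP => [->|].
by rewrite eqxx -ez (@isum_ext _ e)// => j jk; rewrite ltn_eqF.
Qed.

Lemma prefixes_gt0 k : (0 < size (prefixes k))%N.
Proof.
have [e he] := choice Ds_neq0.
by have := isum_prefixes k he; case: (prefixes k).
Qed.

Lemma digit_bound e : (forall j, e j \in Ds j) -> forall j, enorm (zvec R (e j)) <= B.
Proof. by move=> he j; exact: Ds_bound (he j). Qed.

Lemma digit_set_prefix e k : (forall j, e j \in Ds j) ->
  exists2 x, digit_set x &
    enorm (x - a ^+ k *m zvec R (isum e k)) <= B / (1 - c) * c ^+ k.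
Proof.
move=> he; have [x ex] := sums_to_ex (digit_bound he).
exists x; first by exists e.
by rewrite -psum_isum; apply: sums_to_tail (digit_bound he) ex.
Qed.

Lemma covers_by_prefixes k (delta : R) : B / (1 - c) * c ^+ k <= delta ->
  covers_by digit_set delta (size (prefixes k)).
Proof.
move=> hd; exists [seq a ^+ k *m zvec R y | y : 'cV[int]_n <- prefixes k].
rewrite size_map; split=> // x [e [he ex]].
exists (a ^+ k *m zvec R (isum e k)); first by apply: map_f; exact: isum_prefixes.
by rewrite -psum_isum; apply: le_trans hd; apply: sums_to_tail (digit_bound he) ex.
Qed.

(* Prefixes whose points lie in one ball of radius [c ^+ k] differ by an integer
   vector of bounded entries, so they are separated by their residues modulo
   [b.+1] for a [b] independent of [k]. *)
Lemma prefixes_le_cover : exists Q, forall k (delta : R) N, delta <= c ^+ k ->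
  covers_by digit_set delta N -> (size (prefixes k) <= N * Q)%N.
Proof.
(* Prefixes assigned to one centre differ by an integer vector of length at most [2 * C + 2], hence
   by less than [b.+1] in each entry. *)
set C := B / (1 - c); set b := Num.trunc (2 * C + 2).
exists #|{: 'cV['I_b.+1]_n}| => k delta N dk [cs [<- hcs]].
(* A prefix extends to a point of the set at distance at most [C * c ^+ k], and a centre lies within
   [delta <= c ^+ k] of that point. Outside [prefixes k] the value [0] is arbitrary. *)
have P y : exists p, y \in prefixes k ->
    p \in cs /\ enorm (p - a ^+ k *m zvec R y) <= C * c ^+ k + c ^+ k.
  have [hy|hy] := boolP (y \in prefixes k); last by exists 0.
  have [e [he <-]] := prefixes_isum hy.
  have [x Sx hx] := digit_set_prefix k he.
  have [p pcs hp] := hcs _ Sx; exists p => _; split=> //.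
  apply: le_trans (enormB_le _ x _) _; rewrite enormBC addrC lerD//.
  exact: le_trans hp dk.
have [p hp] := choice P.
have pr_inj : {in prefixes k &, injective (fun y => (p y, modvec b y))}.
  move=> y y' hy hy' [pp rr].
  have [_ l1] := hp _ hy; have [_ l2] := hp _ hy'.
  have ck0 : 0 < c ^+ k by rewrite exprn_gt0.
  have l3 : enorm (zvec R (y - y')) <= 2 * C + 2.
    rewrite -(ler_pM2l ck0) -enorm_Ainv_exp zvecB mulmxBr.
    apply: le_trans (enormB_le _ (p y) _) _.
    rewrite enormBC {2}pp; apply: le_trans (lerD l1 l2) _.
    by rewrite le_eqVlt; apply/orP; left; apply/eqP; ring.
  apply/matrixP => i j; rewrite (ord1 j).
  have l4 : (absz (y i 0 - y' i 0)%R < b.+1)%N.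
    have := le_lt_trans (le_trans (coord_le_enorm _ i) l3) (truncnS_gt _).
    by rewrite !mxE -intr_norm pmulrn ltr_int -/b.
  have := modvec_dvd rr i; rewrite dvdzE /= => bd.
  apply/eqP; rewrite -subr_eq0 -absz_eq0; apply: contraLR bd.
  by rewrite -lt0n => h; rewrite gtnNdvd.
rewrite -(size_map (fun y => (p y, modvec b y))).
apply: (@leq_trans (size [seq (x, y) | x <- cs, y <- enum {: 'cV['I_b.+1]_n}])); last first.
  by rewrite size_allpairs -cardE.
apply: uniq_leq_size; first by rewrite map_inj_in_uniq// uniq_prefixes.
move=> _ /mapP[y hy ->]; apply: allpairs_f; last by rewrite mem_enum.
by have [] := hp _ hy.
Qed.

(** For [delta] between [c ^+ k.+1] and [c ^+ k], prefixes of two lengths near [k] bound the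
    covering number from both sides. Its logarithm is [al * ln delta / ln c] up to a bounded error,
    which disappears on division by [- ln delta]. *)
Lemma has_box_dim_digit_set (al E : R) : 0 <= al ->
  (forall k, `|ln (size (prefixes k))%:R - al * k%:R| <= E) ->
  has_box_dim digit_set (al / - ln c).
Proof.
move=> al0 hE; have [e he] := choice Ds_neq0.
have [x0 Sx0 _] := digit_set_prefix 0 he.
split; first by exists x0.
split.
  exists (B / (1 - c)) => x [f [hf fx]].
  have := sums_to_tail 0 (digit_bound hf) fx.
  by rewrite /psum big_ord0 subr0 expr0 mulr1.
have [Q hQ] := prefixes_le_cover.
(* There is one prefix of length [0], and [Q = 0] would bound their number by [0]. *)
have Q0 : (0 < Q)%N.
  rewrite lt0n; apply/eqP => Q0.
  have [k0 hk0] := eventually_geometric_lt (B / (1 - c)) ltr01.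
  have := hQ 0%N 1 _ _ (covers_by_prefixes (ltW hk0)).
  by rewrite expr0 lexx Q0 muln0 => /(_ isT).
(* With [p] further digits the covering radius [B / (1 - c) * c ^+ k] drops below [c ^+ k]. *)
have [p hp] := eventually_geometric_lt (B / (1 - c)) ltr01.
have L0 : 0 < - ln c by rewrite oppr_gt0 ln_lt0.
set L := - ln c in L0 *.
(* Error budget: [E] from the hypothesis, [al * (p%:R + 2)] for the rounding of the scale and the
   [p] extra digits, [ln Q%:R] for prefixes sharing a ball. *)
set E' := E + al * (p%:R + 2) + ln Q%:R.
have lnQ : 0 <= ln (Q%:R : R) by rewrite ln_ge0// ler1n.
have key (delta : R) : 0 < delta < 1 ->
    `|ln (Ncov digit_set delta)%:R - al / L * - ln delta| <= E'.
  move=> /andP[d0 d1]; set l := - ln delta.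
  have l0 : 0 < l by rewrite oppr_gt0 ln_lt0// d0.
  have lL0 : 0 <= l / L by rewrite divr_ge0 ?ltW.
  (* As [l / L] is [ln delta / ln c], its integer part [k] gives [c ^+ k.+1 <= delta <= c ^+ k]. *)
  have /andP[k1 k2] := truncn_itv lL0; set k := Num.trunc _ in k1 k2.
  have dE : delta = expR (- l) by rewrite opprK lnK.
  have cE j : c ^+ j = expR (- (j%:R * L)).
    by rewrite -mulrN opprK expRM_natl lnK.
  have ck : delta <= c ^+ k by rewrite dE cE ler_expR lerN2 -ler_pdivlMr.
  have ck1 : c ^+ k.+1 <= delta.
    by rewrite dE cE ler_expR lerN2 -ler_pdivrMr// ltW.
  have up : B / (1 - c) * c ^+ (k.+1 + p) <= delta.
    rewrite exprD mulrCA; apply: le_trans ck1.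
    by rewrite ler_piMr ?exprn_ge0 ?ltW.
  have [N1 N2] := NcovP (covers_by_prefixes up).
  have {}N2 := N2 _ (covers_by_prefixes up).
  have {N1} := hQ _ _ _ ck N1; set N := Ncov _ _ in N2 *; move=> N1.
  have M0 j : 0 < (size (prefixes j))%:R :> R by rewrite ltr0n prefixes_gt0.
  have N0 : (0 < N)%N.
    by have := leq_trans (prefixes_gt0 k) N1; rewrite muln_gt0 => /andP[].
  have N0R : 0 < N%:R :> R by rewrite ltr0n.
  have u : ln N%:R <= ln (size (prefixes (k.+1 + p)))%:R :> R.
    by rewrite ler_ln ?posrE// ler_nat.
  have v : ln (size (prefixes k))%:R <= ln N%:R + ln Q%:R :> R.
    rewrite -lnM ?posrE ?ltr0n// -natrM ler_ln ?posrE//; last first.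
      by rewrite ltr0n muln_gt0 N0.
    by rewrite ler_nat.
  have := hE (k.+1 + p)%N; rewrite ler_norml => /andP[_ h1].
  have := hE k; rewrite ler_norml => /andP[h2 _].
  have -> : al / L * l = al * (l / L) by ring.
  have w1 : al * k%:R <= al * (l / L) by rewrite ler_wpM2l.
  have w2 : al * (l / L) <= al * k.+1%:R by rewrite ler_wpM2l// ltW.
  have w3 : 0 <= al * p%:R by rewrite mulr_ge0.
  rewrite /E' ler_norml; rewrite natrD mulrDr in h1.
  rewrite -natr1 mulrDr mulr1 in w2 h1.
  rewrite mulrDr; clear -h1 h2 u v w1 w2 w3 lnQ al0.
  by apply/andP; split; lra.
apply/cvgrPdist_le => eps eps0.
near=> delta.
have d0 : 0 < delta by near: delta; exact: nbhs_right_gt.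
have d1 : delta < 1 by near: delta; apply: nbhs_right_lt.
have d2 : delta < expR (- (E' / eps)).
  by near: delta; apply: nbhs_right_lt; exact: expR_gt0.
have l0 : 0 < - ln delta by rewrite oppr_gt0 ln_lt0// d0.
have := key delta; rewrite d0 d1 => /(_ isT) h.
have l1 : E' <= eps * - ln delta.
  rewrite -ler_pdivrMl// mulrC lerNr -ler_expR lnK ?posrE//.
  exact: ltW.
rewrite -(ler_pM2r l0); apply: le_trans l1; apply: le_trans h.
set l := - ln delta in l0 *; rewrite -[X in _ * X <= _](gtr0_norm l0) -normrM.
by rewrite mulrBl divfK ?gt_eqF// distrC.
Unshelve. all: by end_near.
Qed.

End DigitSets.

(** * Intersections of translates and density of level sets *)

Section Intersections.
Variables (Dc : set 'cV[int]_n) (s : seq 'cV[int]_n) (B : R).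
Hypothesis residues : complete_residue_system A Dc.
Hypothesis s_sub : forall d, d \in s -> Dc d.
Hypothesis s_uniq : uniq s.
Hypothesis s_bound : forall d, d \in s -> enorm (zvec R d) <= B.
Let D : set 'cV[int]_n := [set` s].
Hypothesis unique_rep : forall x e e',
  is_rep A (diffset D) e x -> is_rep A (diffset D) e' x -> e = e'.

Lemma diff_bound d : diffset D d -> enorm (zvec R d) <= 2 * B.
Proof.
move=> [d1 [d2 [h1 [h2 ->]]]]; rewrite zvecB mulr_natl mulr2n.
apply: le_trans (enormD _ _) _; rewrite enormN.
by apply: lerD; exact: s_bound.
Qed.

(** If [e] and [f] are digit sequences in [D] of [x] and [x - alpha i], then [e - f] represents
    [alpha i], so by uniqueness it is [g i] and [e j - g i j] lies in [D]. Conversely, subtracting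
    [g i] termwise gives digits of [x - alpha i]. *)
Lemma Tinter_digit_set m (alpha : 'I_m -> 'cV[R]_n) (g : 'I_m -> nat -> 'cV[int]_n) :
  (forall i, is_rep A (diffset D) (g i) (alpha i)) ->
  Tinter A D alpha =
  digit_set (fun j => [seq d <- s | [forall i, d - g i j \in s]]).
Proof.
move=> hg; apply/seteqP; split => x.
  move=> [[e [he ex]] hx]; exists e; split=> // j.
  rewrite mem_filter (he j : _ \in s) andbT; apply/forallP => i.
  have [f [hf fx]] := hx i.
  have -> : g i = (fun j => e j - f j).
    apply: unique_rep (hg i) _; split; first by move=> k; exists (e k), (f k).
    by have := sums_toB ex fx; rewrite opprB addrC subrK.
  by rewrite opprB addrC subrK; exact: hf.
move=> [e [he ex]]; split.
  exists e; split=> // k.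
  have := he k; rewrite mem_filter => /andP[_ h]; exact: h.
move=> i; exists (fun j => e j - g i j); split.
  move=> k; have := he k; rewrite mem_filter => /andP[/forallP/(_ i) h _]; exact: h.
exact: sums_toB ex (hg i).2.
Qed.

(** With the constant digit set [s] the prefix count is exactly a power of [size s], so the error is
    [0]; limits are unique. *)
Lemma box_dim_Tset dimT : has_box_dim (Tset A D) dimT ->
  dimT = ln (size s)%:R / - ln c.
Proof.
move=> [[x [e [he _]]] [_ lim1]].
have e0s : e 0%N \in s := he 0%N.
have sz0 : (0 < size s)%N by case: (s) e0s.
have s0 : 0 <= ln ((size s)%:R : R) by rewrite ln_ge0// ler1n.
have [] := @has_box_dim_digit_set Dc (fun _ => s) B residues (fun _ => s_sub)
  (fun _ => s_uniq) (fun _ => ex_intro (fun d => d \in s) _ e0s) (fun _ => s_bound)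
  (ln (size s)%:R) 0 s0.
  move=> k; rewrite size_prefixes prod_nat_const card_ord natrX lnXn.
    by rewrite mulr_natr subrr normr0.
  by rewrite ltr0n.
move=> _ [_ lim2]; exact: (cvg_unique (@norm_hausdorff _ _) lim1 lim2).
Qed.

Lemma dense_level_set m dimT lam : (0 < m)%N -> has_box_dim (Tset A D) dimT ->
  0 <= lam <= dimT -> dense_in (level_set A D lam) (@Fset R n m A D).
Proof.
move=> m0 hT /andP[lam0 lamT] alpha [halpha [x0 Tx0]] eps eps0.
have dimTE := box_dim_Tset hT.
have [x [e0 [he0 _]]] := hT.1; have d0s : e0 0%N \in s := he0 0%N.
have [d1 [d2 [d1s d2s d12]]] := singleton_translate d0s.
(* The frequency of the digit [0]. If [dimT = 0], then [lam = 0], and [t = 0] since the inverse of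
   [0] is [0]. *)
pose t := lam / dimT.
have T0 : 0 <= dimT := le_trans lam0 lamT.
have t01 : 0 <= t <= 1.
  rewrite /t divr_ge0//=; have [->|T1] := eqVneq dimT 0; first by rewrite invr0 mulr0 ler01.
  by rewrite ler_pdivrMr ?mul1r// lt_def T1.
have lamE : lam = t * ln (size s)%:R / - ln c.
  rewrite -mulrA -dimTE /t; have [T1|T1] := eqVneq dimT 0; last by rewrite divfK.
  by rewrite T1 mulr0; apply/eqP; rewrite eq_le lam0 andbT -T1.
have [g hg] := choice halpha.
rewrite (Tinter_digit_set hg) in Tx0; have [e [he _]] := Tx0.
(* Digits in [D - D] have norm at most [2 * B]; the outer factor [2] adds the tails of the old and
   the new expansion. *)
have [K hK] := eventually_geometric_lt (2 * (2 * B / (1 - c))) eps0.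
(* After the first [K] digits [h i j] does not depend on [i], so the [m] conditions on a digit
   coincide there. *)
pose h i j := if (j < K)%N then g i j
  else if (beatty t j < beatty t j.+1)%N then 0 else d1 - d2.
have hD i j : diffset D (h i j).
  rewrite /h; case: ifP => _; first exact: (hg i).1.
  case: ifP => _; first by exists d1, d1; rewrite subrr.
  by exists d1, d2.
have hB i j : enorm (zvec R (h i j)) <= 2 * B := diff_bound (hD i j).
have gB i j : enorm (zvec R (g i j)) <= 2 * B := diff_bound ((hg i).1 j).
have [beta hbeta] := choice (fun i => sums_to_ex (hB i)).
have hrep i : is_rep A (diffset D) (h i) (beta i).
  by split; [exact: hD | exact: hbeta].
pose Ds j := [seq d <- s | [forall i, d - h i j \in s]].
have Ds_s j d : d \in Ds j -> d \in s by rewrite mem_filter => /andP[].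
(* Before [K] the digits of a point of the given intersection are admissible; afterwards [d1] always
   is. *)
have Ds_neq0 j : exists d, d \in Ds j.
  have [jK|Kj] := ltnP j K.
    exists (e j); have := he j; rewrite !mem_filter => /andP[/forallP h1 ->].
    by rewrite andbT; apply/forallP => i; rewrite /h jK.
  exists d1; rewrite mem_filter d1s andbT; apply/forallP => i.
  rewrite /h ltnNge Kj/=; case: ifP => _; first by rewrite subr0.
  by rewrite opprB addrC subrK.
have Ds_gt0 j : (0 < size (Ds j))%N by have [d] := Ds_neq0 j; case: (Ds j).
have Ds_size j : (K <= j)%N ->
    size (Ds j) = if (beatty t j < beatty t j.+1)%N then size s else 1%N.
  move=> Kj; case: ifP => bj.
    congr size; apply/all_filterP/allP => d ds; apply/forallP => i.
    by rewrite /h ltnNge Kj/= bj subr0.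
  apply/eqP; rewrite eqn_leq Ds_gt0 andbT /Ds.
  apply: (@uniq_leq_size _ _ [:: d1]); first exact: filter_uniq.
  (* A single translate, available because [0 < m], already forces the digit [d1]. *)
  move=> d; rewrite mem_filter mem_seq1 => /andP[/forallP/(_ (Ordinal m0))].
  rewrite /h ltnNge Kj/= bj => dd ds.
  by apply/eqP; exact: d12.
have bd := @has_box_dim_digit_set Dc Ds B residues
  (fun j d dj => s_sub (Ds_s j d dj)) (fun j => filter_uniq _ s_uniq) Ds_neq0
  (fun j d dj => s_bound (Ds_s j d dj))
  (t * ln (size s)%:R) ((K%:R + 1) * ln (size s)%:R).
have {}bd : has_box_dim (Tinter A D beta) lam.
  rewrite (Tinter_digit_set hrep) lamE; apply: bd.
    have /andP[t0 _] := t01; rewrite mulr_ge0// ln_ge0// ler1n.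
    by case: (s) d0s.
  move=> k; rewrite size_prefixes.
  apply: (@ln_prod_beatty _ t (size s) K (fun j => size (Ds j))) => // j.
  by rewrite Ds_gt0 size_filter count_size.
exists beta.
  (* Nonemptiness of the intersection, required by [Fset], is part of [has_box_dim]. *)
  split=> //; split; last exact: bd.1.
  by move=> i; exists (h i).
move=> i; apply: le_lt_trans hK.
apply: le_trans (enormB_le _ (psum R A (g i) K) _) _.
rewrite -mulrA [X in _ <= X]mulr_natl mulr2n; apply: lerD.
  exact: sums_to_tail (gB i) (hg i).2.
have -> : psum R A (g i) K = psum R A (h i) K.
  by apply: eq_bigr => j _; rewrite /h ltn_ord.
by rewrite enormBC; exact: sums_to_tail (hB i) (hbeta i).
Qed.

End Intersections.

End Expansions.

(** * Reduction to a finite list of digits *)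

Theorem mainTheorem13 (R : realType) (n : nat) (A : 'M[int]_n)
  (Dc D : set 'cV[int]_n) (m : nat) :
  \det A != 0 ->
  inv_similarity R A ->
  complete_residue_system A Dc ->
  D `<=` Dc ->
  (forall (x : 'cV[R]_n) (e e' : nat -> 'cV[int]_n),
      is_rep A (diffset D) e x -> is_rep A (diffset D) e' x -> e = e') ->
  (0 < m)%N ->
  forall dimT lam : R, has_box_dim (Tset A D) dimT ->
    0 <= lam <= dimT ->
    dense_in (level_set A D lam) (@Fset R n m A D).
Proof.
move=> detA [c [c01 simA]] residues DDc unique_rep m0 dimT lam.
have /finite_seqP[s0 Ds0] := sub_finite_set DDc (residue_system_finite detA residues).
have Ds : D = [set` undup s0].
  by rewrite Ds0; apply/seteqP; split => d /=; rewrite mem_undup.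
rewrite Ds in DDc unique_rep *; set s := undup s0 in DDc unique_rep *.
(* The sum of all digit norms serves as the common bound [B]. *)
apply: (@dense_level_set R n A c detA c01 simA Dc s
  (\sum_(d <- s) enorm (zvec R d)) residues DDc (undup_uniq _) _ unique_rep _ _ _ m0).
move=> d ds; rewrite (big_rem d)//= lerDl.
by apply: sumr_ge0 => d' _; exact: enorm_ge0.
Qed.
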